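(* Let $A$ be a proper unital $*$-ring such that $A_\Sigma\cap-A_\Sigma=\{0\}$, and let $p,q\in\mathcal{P}$. Then $$pq\in\mathcal{I}\ \Leftrightarrow\ pq=qp,\qquad p+q\in\mathcal{I}\ \Leftrightarrow\ pq=0,\qquad p-q\in\mathcal{I}\ \Leftrightarrow\ q=qp.$$
   Context: A $*$-ring is an associative ring with a map $a\mapsto a^*$ satisfying $a^{**}=a$, $(ab)^*=b^*a^*$, $(a+b)^*=a^*+b^*$; it is proper if $a^*a=0$ implies $a=0$. Unital means having a two-sided unit $1$. $A_\Sigma$ is the set of all finite sums $\sum_{k=1}^n a_k^*a_k$ with $n\geq1$, $a_k\in A$. $\mathcal{I}=\{p\in A:p=p^2\}$ is the set of idempotents and $\mathcal{P}=\{p\in A:p=pp^*\}$ is the set of projections (equivalently, self-adjoint idempotents). *)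

(* Defs.v *)
From mathcomp Require Import all_boot all_algebra.
From mathcomp Require Import boolp classical_sets.

Set Implicit Arguments.
Unset Strict Implicit.
Unset Printing Implicit Defensive.

Import GRing.Theory.

Local Open Scope classical_set_scope.
Local Open Scope ring_scope.

(* Unital associative rings are [pzRingType]s, which include the zero ring:
   1 <> 0 is not assumed. *)
Section StarRing.
Variables (A : pzRingType) (star : A -> A).

Record is_star : Prop := IsStar {
  starK : forall a, star (star a) = a;
  starM : forall a b, star (a * b) = star b * star a;
  starD : forall a b, star (a + b) = star a + star b
}.

Definition proper_star : Prop := forall a, star a * a = 0 -> a = 0.

(* Only nonempty sums are allowed, hence the index type 'I_n.+1. *)
Definition star_sums : set A :=
  [set x | exists (n : nat) (a : 'I_n.+1 -> A),
             x = \sum_(k < n.+1) star (a k) * a k].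

Definition idempotents : set A := [set p | p = p * p].

Definition projections : set A := [set p | p = p * star p].

End StarRing.

Arguments idempotents {A}.

(* Main.v *)
Require Import Defs.
From mathcomp Require Import all_boot all_algebra.
From mathcomp Require Import boolp classical_sets.

Set Implicit Arguments.
Unset Strict Implicit.
Unset Printing Implicit Defensive.

Import GRing.Theory.

Local Open Scope classical_set_scope.
Local Open Scope ring_scope.

(** Each nontrivial implication comes from showing that some [star a * a] vanishes
and then using properness.  If [p * q] is idempotent, then for [a := q * p - p * q * p]
one gets [star a * a = p * q * p - p * q * p * q * p = 0], so [q * p] equals the
self-adjoint element [p * q * p] and [p] and [q] commute.  If [p + q] (resp.
[p - q]) is idempotent, sandwiching the resulting equation between [p] and [p]
(resp. [q] and [q]) only gives that twice [star a * a] is zero, for [a := q * p]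
(resp. [a := q - p * q]); the hypothesis on sums of squares is what removes the
factor 2 ([star_sq_double0]), since then [star a * a] is its own opposite. *)

Section StarRingLemmas.
Variables (A : pzRingType) (star : A -> A).
Hypothesis Hstar : is_star star.

Lemma star0 : star 0 = 0.
Proof. by apply: (addrI (star 0)); rewrite -(starD Hstar) !addr0. Qed.

Lemma starN a : star (- a) = - star a.
Proof. by apply: (addrI (star a)); rewrite -(starD Hstar) !subrr star0. Qed.

Lemma starB a b : star (a - b) = star a - star b.
Proof. by rewrite (starD Hstar) starN. Qed.

(** The right-hand side [p * star p] is self-adjoint. *)
Lemma projection_star p : projections star p -> star p = p.
Proof. by move=> Hp; rewrite Hp (starM Hstar) (starK Hstar). Qed.

Lemma projection_idem p : projections star p -> p * p = p.
Proof. by move=> Hp; rewrite -{2}(projection_star Hp); symmetry; exact: Hp. Qed.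

(** If [star a * a] equals its opposite, it lies both in the set of sums of
squares and in its negative; this is the only way 2-torsion is excluded. *)
Lemma star_sq_double0 a : proper_star star ->
    star_sums star `&` [set - x | x in star_sums star] = [set 0] ->
  star a * a + star a * a = 0 -> a = 0.
Proof.
move=> Hproper Hsums aa0; apply: Hproper.
have aaS : star_sums star (star a * a).
  by exists 0%N, (fun=> a); rewrite big_ord1.
suff : [set 0] (star a * a) by [].
rewrite -Hsums; split=> //; exists (star a * a) => //.
by apply: (addrI (star a * a)); rewrite subrr aa0.
Qed.

Section TwoProjections.
Variables p q : A.
Hypotheses (Hp : projections star p) (Hq : projections star q).

Lemma idempotents_projM : proper_star star ->
  idempotents (p * q) <-> p * q = q * p.
Proof.
have [sp sq] := (projection_star Hp, projection_star Hq).
have [pp qq] := (projection_idem Hp, projection_idem Hq).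
move=> Hproper; rewrite /idempotents /=; split=> [pqI | pqC]; last first.
  by rewrite {3}pqC -mulrA (mulrA q) qq -pqC mulrA pp.
have qpE : q * p = p * q * p.
  apply/eqP; rewrite -subr_eq0; apply/eqP/Hproper.
  rewrite starB !(starM Hstar) sp sq mulrBr !mulrBl !mulrA.
  rewrite -(mulrA p q q) qq -(mulrA (p * q) p p) pp -(mulrA (p * q) p q) -pqI.
  by rewrite subrr.
by rewrite qpE -[LHS](starK Hstar) (starM Hstar) sp sq qpE !(starM Hstar) sp sq
           mulrA.
Qed.

Section FormallyReal.
Hypotheses (Hproper : proper_star star)
  (Hsums : star_sums star `&` [set - x | x in star_sums star] = [set 0]).

Lemma idempotents_projD : idempotents (p + q) <-> p * q = 0.
Proof.
have [sp sq] := (projection_star Hp, projection_star Hq).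
have [pp qq] := (projection_idem Hp, projection_idem Hq).
have sqrE : (p + q) * (p + q) = p + q + (p * q + q * p).
  by rewrite mulrDl !mulrDr pp qq [q * p + q]addrC addrACA.
rewrite /idempotents /= sqrE; split=> [pqI | pq0]; last first.
  have qp0 : q * p = 0 by rewrite -sp -sq -(starM Hstar) pq0 star0.
  by rewrite pq0 qp0 !addr0.
have pqN : p * q + q * p = 0 by apply: (addrI (p + q)); rewrite -pqI addr0.
have qp0 : q * p = 0.
  apply: star_sq_double0 => //.
  rewrite (starM Hstar) sp sq mulrA -(mulrA p q q) qq.
  (* twice [p * q * p] is [p * (p * q + q * p) * p] *)
  have := congr1 (fun x => p * x * p) pqN.
  by rewrite mulr0 mul0r mulrDr mulrDl !mulrA pp -(mulrA (p * q)) pp.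
by rewrite -pqN qp0 addr0.
Qed.

Lemma idempotents_projB : idempotents (p - q) <-> q = q * p.
Proof.
have [sp sq] := (projection_star Hp, projection_star Hq).
have [pp qq] := (projection_idem Hp, projection_idem Hq).
rewrite /idempotents /=; split=> [pqI | qE]; last first.
  have qE' : p * q = q by rewrite -[LHS](starK Hstar) (starM Hstar) sp sq -qE.
  by rewrite mulrBl !mulrBr pp qq qE' -qE subrr subr0.
have qqE : q + q = p * q + q * p.
  move: pqI; rewrite mulrBl !mulrBr pp qq opprB addrACA -opprD => pqI.
  rewrite -[RHS](subKr (p + q)) -pqI opprB [p + q]addrC addrACA subrr.
  by rewrite addr0.
have aE : q - p * q = 0.
  apply: star_sq_double0 => //.
  rewrite starB (starM Hstar) sp sq mulrBr !mulrBl qq !mulrA.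
  rewrite -(mulrA q p p) pp subrr subr0.
  (* sandwiching [q + q = p * q + q * p] between [q] and [q] *)
  have := congr1 (fun x => q * x * q) qqE.
  rewrite !mulrDr !mulrDl !mulrA !qq -(mulrA (q * p)) qq => qqE'.
  by rewrite addrACA qqE' -opprD subrr.
by have := congr1 star (subr0_eq aE); rewrite (starM Hstar) sp sq.
Qed.

End FormallyReal.
End TwoProjections.
End StarRingLemmas.

Theorem mainTheorem8 (A : pzRingType) (star : A -> A)
    (Hstar : is_star star) (Hproper : proper_star star)
    (Hsums : star_sums star `&` [set - x | x in star_sums star] = [set 0])
    (p q : A) (Hp : projections star p) (Hq : projections star q) :
  [/\ idempotents (p * q) <-> p * q = q * p,
      idempotents (p + q) <-> p * q = 0
    & idempotents (p - q) <-> q = q * p].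
Proof.
by split; [exact: (idempotents_projM Hstar Hp Hq Hproper)
  | exact: (idempotents_projD Hstar Hp Hq Hproper Hsums)
  | exact: (idempotents_projB Hstar Hp Hq Hproper Hsums)].
Qed.
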